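(* Let $T=\{2143,2341,4231\}$. Then $$F_T(x)=\frac{1-6x+13x^2-11x^3+5x^4}{(1-x)^2(1-2x)(1-3x+x^2)}.$$
   Context: $S_n(T)$ denotes the set of permutations $\pi$ of $[n]=\{1,\dots,n\}$ (one-line notation) that avoid every pattern $\tau\in T$, i.e. no subsequence of $\pi$ is order-isomorphic to $\tau$. $F_T(x)=\sum_{n\ge 0}|S_n(T)|x^n$, a formal power series, with $|S_0(T)|=1$. *)

(* Defs.v *)
From mathcomp Require Import all_boot all_order all_fingroup all_algebra.
Set Implicit Arguments.
Unset Strict Implicit.
Unset Printing Implicit Defensive.
Import Order.TTheory GRing.Theory Num.Theory.

Section Patterns.
Local Open Scope nat_scope.

(* 'I_n is {0, ..., n-1}; values are shifted by one to get a word over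
   {1, ..., n}. *)
Definition one_line (n : nat) (s : 'S_n) : seq nat :=
  [seq (s i).+1 | i <- enum 'I_n].

(* Patterns are likewise one-line words, e.g. [:: 2; 1; 4; 3] for 2143. *)
Definition order_iso (u v : seq nat) : bool :=
  (size u == size v) &&
  [forall i : 'I_(size u), forall j : 'I_(size u),
     (nth 0 u i < nth 0 u j) == (nth 0 v i < nth 0 v j)].

(* A boolean mask selects a subsequence, that is, a set of positions. *)
Definition contains (w t : seq nat) : bool :=
  [exists m : (size w).-tuple bool, order_iso (mask m w) t].

Definition avoiders (T : seq (seq nat)) (n : nat) : {set 'S_n} :=
  [set s : 'S_n | all (fun t => ~~ contains (one_line s) t) T].

Lemma order_isoP (u v : seq nat) :
  reflect (size u = size v /\
           forall i j, i < size u -> j < size u ->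
             (nth 0 u i < nth 0 u j) = (nth 0 v i < nth 0 v j))
          (order_iso u v).
Proof.
apply: (iffP andP) => [[/eqP eq_sz /forallP iso] | [eq_sz iso]].
  split=> // i j ltiu ltju.
  by have /forallP/(_ (Ordinal ltju))/eqP := iso (Ordinal ltiu).
split; first exact/eqP.
by apply/forallP=> i; apply/forallP=> j; apply/eqP/iso.
Qed.

Lemma containsP (w t : seq nat) :
  reflect (exists2 u, subseq u w & order_iso u t) (contains w t).
Proof.
apply: (iffP existsP) => [[m iso] | [u /subseqP[m sz_m ->] iso]].
  by exists (mask m w) => //; apply: mask_subseq.
by exists (tcast sz_m (in_tuple m)); rewrite val_tcast.
Qed.

End Patterns.

Local Open Scope ring_scope.

(* A series is its sequence of coefficients; equality is pointwise (=1). *)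
Definition fps (R : Type) : Type := nat -> R.

Section FormalPowerSeries.
Variable R : fieldType.
Implicit Types a b : fps R.

Definition fps_poly (p : {poly R}) : fps R := fun n => p`_n.

Definition fps_mul a b : fps R := fun n => \sum_(k < n.+1) a k * b (n - k)%N.

(* The coefficients of index 0, ..., n of the inverse of a series a with
   a 0 != 0: b_0 = a_0^-1 and
   b_(n+1) = - a_0^-1 (a_1 b_n + a_2 b_(n-1) + ... + a_(n+1) b_0). *)
Fixpoint fps_inv_coefs a (n : nat) : seq R :=
  if n is m.+1 then
    let s := fps_inv_coefs a m in
    rcons s (- (a 0%N)^-1 * \sum_(k < m.+1) a k.+1 * s`_(m - k))
  else [:: (a 0%N)^-1].

Definition fps_inv a : fps R := fun n => (fps_inv_coefs a n)`_n.

Definition fps_div a b : fps R := fps_mul a (fps_inv b).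

Lemma size_fps_inv_coefs a n : size (fps_inv_coefs a n) = n.+1.
Proof. by elim: n => //= n IHn; rewrite size_rcons IHn. Qed.

Lemma nth_fps_inv_coefs a n i :
  (i <= n)%N -> (fps_inv_coefs a n)`_i = fps_inv a i.
Proof.
elim: n => [|n IHn]; first by rewrite leqn0 => /eqP->.
rewrite leq_eqVlt => /predU1P[-> // | lt_in] /=.
by rewrite nth_rcons size_fps_inv_coefs lt_in IHn.
Qed.

Lemma fps_mulV a : a 0%N != 0 -> fps_mul a (fps_inv a) =1 fps_poly 1.
Proof.
move=> a0 [|n]; rewrite /fps_mul /fps_poly coef1 big_ord_recl subn0.
  by rewrite big_ord0 addr0 /fps_inv /= divff.
rewrite {1}/fps_inv /= nth_rcons size_fps_inv_coefs ltnn eqxx.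
rewrite mulNr mulrN mulVKf //.
rewrite (eq_bigr (fun k : 'I_n.+1 => a k.+1 * fps_inv a (n - k)%N)).
  by rewrite addNr.
by move=> k _; rewrite nth_fps_inv_coefs ?leq_subr.
Qed.

End FormalPowerSeries.

Definition gen_fun (T : seq (seq nat)) : fps rat :=
  fun n => #|avoiders T n|%:R.

(* Main.v *)
(* Avoiders are counted by their first letter: a word of length n+1 is
   x :: map (bump x) w with w of length n, and prepending x only forbids
   patterns of w relative to the cut between "low" letters (< x) and "high"
   letters (>= x).  If there is a low letter and at least two high ones, then
   2143 and 2341 (with x as the letter 2) force the maximum of w to be its
   first or its last letter.  Deleting that maximum leaves the conditions at
   the cut unchanged, which turns the sums over x into linear recurrences.
   After a leading maximum, avoiding T amounts to avoiding U = {231, 2143};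
   |S_n(U)| is a bisection of the Fibonacci numbers, and all the other counts
   are combinations of it, of 2^n and of n. *)
Require Import Defs.
From mathcomp Require Import all_boot all_order all_fingroup all_algebra.
From mathcomp Require Import zify ring lra.
Set Implicit Arguments.
Unset Strict Implicit.
Unset Printing Implicit Defensive.
Import GRing.Theory.

(** * Avoidance of a predicate on subsequences *)

Section Avoidance.
Implicit Types (P Q : pred (seq nat)) (w u : seq nat) (x n : nat).

(** [P] plays the role of the pattern. Recursion on the word sorts its subsequences by whether they
    use the first letter, so peeling off a letter is definitional. *)
Fixpoint avd P w : bool :=
  if w is x :: w' then avd (fun u => P (x :: u)) w' && avd P w' else ~~ P [::].

Lemma avdP P w : reflect (forall u, subseq u w -> ~~ P u) (avd P w).
Proof.
elim: w P => [|x w IHw] P /=.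
  by apply: (iffP idP) => [nP [|y u] | /(_ [::])->].
apply: (iffP andP) => [[/IHw avPx /IHw avP] [|y u] //= | avP].
- by move=> _; apply: avP; apply: sub0seq.
- by case: eqP => [-> /avPx | _ /avP].
split; apply/IHw => u su; apply: avP; first by rewrite /= eqxx.
exact: subseq_trans su (subseq_cons w x).
Qed.

Lemma avd_cons P x w : avd P (x :: w) = avd (fun u => P (x :: u)) w && avd P w.
Proof. by []. Qed.

Lemma eq_in_avd P Q w :
  (forall u, {subset u <= w} -> P u = Q u) -> avd P w = avd Q w.
Proof.
move=> eqPQ; apply/avdP/avdP => av u su; have /eqPQ := mem_subseq su.
  by move=> <-; apply: av.
by move=> ->; apply: av.
Qed.

Lemma avd_sub P Q w :
  (forall u, {subset u <= w} -> P u -> Q u) -> avd Q w -> avd P w.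
Proof.
move=> PQ /avdP avQ; apply/avdP => u su; apply: contra (avQ u su).
exact/PQ/mem_subseq.
Qed.

Lemma avdF P w : (forall u, {subset u <= w} -> ~~ P u) -> avd P w.
Proof. by move=> nP; apply/avdP => u /mem_subseq/nP. Qed.

Lemma avd_map P (f : nat -> nat) w :
  avd P (map f w) = avd (fun u => P (map f u)) w.
Proof. by elim: w P => //= x w IHw P; rewrite !IHw. Qed.

Lemma avd_rcons P w x :
  avd P (rcons w x) = avd (fun u => P (rcons u x)) w && avd P w.
Proof.
elim: w P => [|y w IHw] P //=; rewrite !IHw /=.
by do 4![case: (avd _ _) => //=].
Qed.

End Avoidance.

Arguments avd : simpl never.

(** * Permutations as words over 0, ..., n-1 *)

Section Words.
Implicit Types (w u : seq nat) (x n : nat).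

Definition words n := permutations (iota 0 n).

Lemma mem_words n w : (w \in words n) = perm_eq w (iota 0 n).
Proof. exact: mem_permutations. Qed.

Lemma words_uniq n w : w \in words n -> uniq w.
Proof. by rewrite mem_words => /perm_uniq->; apply: iota_uniq. Qed.

Lemma words_mem n w : w \in words n -> w =i gtn n.
Proof. by rewrite mem_words => /perm_mem eqw x; rewrite eqw mem_iota. Qed.

Lemma words_size n w : w \in words n -> size w = n.
Proof. by rewrite mem_words => /perm_size->; rewrite size_iota. Qed.

Lemma wordsI n w : uniq w -> w =i gtn n -> w \in words n.
Proof.
move=> Uw eqw; rewrite mem_words uniq_perm ?iota_uniq // => x.
by rewrite eqw mem_iota.
Qed.

(** [phi] is a bijection from [words n] onto the longer words satisfying [C], so the filtered list
    is a permutation of the image list; this gives the count for every [P] at once. *)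
Lemma count_words_image n (phi : seq nat -> seq nat) (C P : pred (seq nat)) :
    injective phi ->
    (forall w, w \in words n -> phi w \in words n.+1 /\ C (phi w)) ->
    (forall w, w \in words n.+1 -> C w -> exists2 u, u \in words n & w = phi u) ->
  count [pred w | P w && C w] (words n.+1) = count (fun u => P (phi u)) (words n).
Proof.
move=> phi_inj phiC Cphi.
rewrite -[RHS](count_map phi P) -(count_filter P C); apply/seq.permP: P.
apply: uniq_perm => [||w].
- exact/filter_uniq/permutations_uniq.
- by rewrite map_inj_uniq ?permutations_uniq.
rewrite mem_filter; apply/andP/mapP => [[Cw /Cphi[]// u] | [u /phiC[? ?] ->] //].
by exists u.
Qed.

Lemma count_words_rcons n (P : pred (seq nat)) :
  count [pred w | P w && (last 0 w == n)] (words n.+1)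
    = count (fun u => P (rcons u n)) (words n).
Proof.
apply: count_words_image => [u v /rcons_inj[] // | w Ww | w Ww /eqP wn].
  rewrite last_rcons eqxx; split=> //; apply: wordsI => [|x].
    by rewrite rcons_uniq (words_mem Ww) !inE ltnn (words_uniq Ww).
  by rewrite mem_rcons inE (words_mem Ww) !inE ltnS (leq_eqVlt x n).
case/lastP: w => [|w y] in Ww wn *; first by have := words_size Ww.
rewrite last_rcons in wn; rewrite {y}wn in Ww *; exists w => //.
have := words_uniq Ww; rewrite rcons_uniq => /andP[nw Uw].
apply: wordsI => // x; have := words_mem Ww x.
rewrite mem_rcons !inE ltnS (leq_eqVlt x n).
by case: eqP => //= -> _; rewrite ltnn (negPf nw).
Qed.

Lemma count_words_cons n x (P : pred (seq nat)) : x <= n ->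
  count [pred w | P w && (head 0 w == x)] (words n.+1)
    = count (fun u => P (x :: map (bump x) u)) (words n).
Proof.
move=> le_xn; apply: (count_words_image (phi := fun u => x :: map (bump x) u)).
- by move=> u v [] /inj_map; apply; apply: can_inj (bumpK x).
- move=> w Ww; rewrite /= eqxx; split=> //; apply: wordsI => [|y] /=.
    rewrite map_inj_uniq ?(words_uniq Ww) ?andbT; last exact: can_inj (bumpK x).
    by apply/mapP => -[y _ /eqP]; rewrite (negPf (neq_bump x y)).
  rewrite !inE; have [-> /=|neq_yx /=] := eqVneq y x; first by rewrite ltnS.
  apply/mapP/idP => [[z + ->] | lt_yn].
    by rewrite (words_mem Ww) !inE /bump; lia.
  exists (unbump x y); last by rewrite unbumpKcond (negPf neq_yx).
  by rewrite (words_mem Ww) !inE /unbump; lia.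
move=> [|y w] Ww /= /eqP; first by have := words_size Ww.
move=> eq_yx; rewrite {y}eq_yx in Ww *.
have /= /andP[xw Uw] := words_uniq Ww.
(* [bump x] inverts [unbump x] off [x], and [x] does not occur in [w]. *)
have wK : map (bump x) (map (unbump x) w) = w.
  rewrite -map_comp -[RHS]map_id; apply/eq_in_map => y yw /=.
  by rewrite unbumpKcond; case: eqP xw => [<-|]; rewrite ?yw.
exists (map (unbump x) w); last by rewrite wK.
apply: wordsI => [|y]; first by rewrite -(map_inj_uniq (can_inj (bumpK x))) wK.
rewrite -(mem_map (can_inj (bumpK x))) wK; have := words_mem Ww (bump x y).
by rewrite !inE eq_sym (negPf (neq_bump x y)) /= => ->; rewrite /bump; lia.
Qed.

Lemma count_words_cons_max n (P : pred (seq nat)) :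
  count [pred w | P w && (head 0 w == n)] (words n.+1)
    = count (fun u => P (n :: u)) (words n).
Proof.
rewrite count_words_cons //; apply: eq_in_count => u Wu /=.
rewrite (_ : map _ u = u) // -[RHS]map_id; apply/eq_in_map => y.
by rewrite (words_mem Wu) /bump !inE; lia.
Qed.

Lemma count_words_recl n (P : pred (seq nat)) :
  count P (words n.+1)
    = \sum_(x < n.+1) count (fun u => P ((x : nat) :: map (bump x) u)) (words n).
Proof.
(* The head of a word in [words n.+1] is at most [n], so [inord] does not alter it. *)
rewrite -sum1_count (partition_big (fun w => inord (head 0 w) : 'I_n.+1) xpredT) //=.
apply: eq_bigr => x _; rewrite -count_words_cons ?leq_ord // -sum1_count.
rewrite big_seq_cond [RHS]big_seq_cond; apply: eq_bigl => w /=.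
case Ww: (w \in _) => //=; congr (_ && _); rewrite -val_eqE /= inordK //.
case: w Ww => [|y w] Ww //=; have := words_mem Ww y.
by rewrite mem_head inE.
Qed.

End Words.

(** * Peeling off the first letter *)

Section Statistics.
Implicit Types (w u : seq nat) (x n : nat).

(** The two cases are disjoint: for n > 0 the word has at least two letters, and its maximum occurs
    once. *)
Lemma count_words_ends n (P : pred (seq nat)) : 0 < n ->
    (forall w, w \in words n.+1 -> P w -> (head 0 w == n) || (last 0 w == n)) ->
  count P (words n.+1) = count (fun u => P (n :: u)) (words n)
                         + count (fun u => P (rcons u n)) (words n).
Proof.
move=> n_gt0 Pends; rewrite -count_words_cons_max -count_words_rcons.
rewrite -count_predUI [X in _ + X](_ : _ = 0) ?addn0.
  apply: eq_in_count => w Ww /=; rewrite -andb_orr.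
  by case Pw: (P w) => //=; rewrite Pends.
apply/eqP; rewrite -leqn0 leqNgt -has_count; apply/hasPn => w Ww /=.
apply/negP => /andP[/andP[_ /eqP hw] /andP[_ /eqP lw]].
case: w => [|y [|z w]] in Ww hw lw; have //= := words_size Ww.
  by move=> [] n0; rewrite -n0 in n_gt0.
move=> _; have /= := words_uniq Ww; rewrite /= in hw lw.
by rewrite hw -{1}lw mem_last.
Qed.

(** * Patterns, and what they leave after their first letter *)

Definition p231 u := if u is [:: b; c; a] then a < b < c else false.
Definition p2143 u :=
  if u is [:: b; a; d; c] then [&& a < b, b < c & c < d] else false.
Definition p2341 u :=
  if u is [:: b; c; d; a] then [&& a < b, b < c & c < d] else false.
Definition p4231 u :=
  if u is [:: d; b; c; a] then [&& a < b, b < c & c < d] else false.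

(* In x :: map (bump x) w, the letters below x are those coming from letters
   < x of w, and the letters above x those coming from letters >= x.  Each
   cut pattern is 231, 2143 or 2341 with its first letter removed, that letter
   being played by x. *)
Definition cut31 x u := if u is [:: b; a] then a < x <= b else false.
Definition cut143 x u :=
  if u is [:: a; c; b] then (a < x <= b) && (b < c) else false.
Definition cut341 x u :=
  if u is [:: b; c; a] then (a < x <= b) && (b < c) else false.

(** With m = x and [p231], this is what 4231 leaves when x plays the 4; with m = n, it hides the
    maximum of a word of length n+1. *)
Definition below m (P : pred (seq nat)) u := P u && all (gtn m) u.

Definition avT w := [&& avd p2143 w, avd p2341 w & avd p4231 w].
Definition avU w := avd p231 w && avd p2143 w.

Lemma eq_avd_words P Q n w : w \in words n ->
  (forall u, all (gtn n) u -> P u = Q u) -> avd P w = avd Q w.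
Proof.
move=> Ww eqPQ; apply: eq_in_avd => u suw; apply: eqPQ.
by apply/allP => y /suw; rewrite (words_mem Ww).
Qed.

Lemma avd_words P n w : w \in words n ->
  (forall u, all (gtn n) u -> ~~ P u) -> avd P w.
Proof.
move=> Ww nP; apply: avdF => u suw; apply: nP.
by apply/allP => y /suw; rewrite (words_mem Ww).
Qed.

Lemma avd_rcons_max P n w : w \in words n ->
  (forall u, all (gtn n) u -> ~~ P (rcons u n)) -> avd P (rcons w n) = avd P w.
Proof. by move=> Ww nP; rewrite avd_rcons (avd_words Ww). Qed.

Lemma avd_cons_max P n w : w \in words n ->
  (forall u, all (gtn n) u -> ~~ P (n :: u)) -> avd P (n :: w) = avd P w.
Proof. by move=> Ww nP; rewrite avd_cons (avd_words Ww). Qed.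

(** The patterns have at most four letters: split on the length, then compare entries by linear
    arithmetic. *)
Ltac by_entries :=
  move=> [|? [|? [|? [|? [|? ?]]]]] //=; rewrite ?/below /= ?/bump; lia.

(** [Q] describes the occurrences that start with the new letter [x], [R] those inside the rest. *)
Lemma avd_cons_bump P Q R n x w : w \in words n ->
    (forall u, all (gtn n) u -> P (x :: map (bump x) u) = Q u) ->
    (forall u, all (gtn n) u -> P (map (bump x) u) = R u) ->
  avd P (x :: map (bump x) w) = avd Q w && avd R w.
Proof.
move=> Ww PQ PR; rewrite avd_cons !avd_map.
by congr andb; apply: (eq_avd_words Ww).
Qed.

Lemma avU_cons n x w : w \in words n -> avU (x :: map (bump x) w) =
  [&& avU w, avd (cut31 x) w & avd (cut143 x) w].
Proof.
move=> Ww; rewrite /avU.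
rewrite (avd_cons_bump (P := p231) (Q := cut31 x) (R := p231) Ww); try by_entries.
rewrite (avd_cons_bump (P := p2143) (Q := cut143 x) (R := p2143) Ww);
  try by_entries.
by do 4![case: (avd _ _) => //=].
Qed.

Lemma avT_cons n x w : w \in words n -> avT (x :: map (bump x) w) =
  [&& avT w, avd (cut143 x) w, avd (cut341 x) w & avd (below x p231) w].
Proof.
move=> Ww; rewrite /avT.
rewrite (avd_cons_bump (P := p2143) (Q := cut143 x) (R := p2143) Ww); try by_entries.
rewrite (avd_cons_bump (P := p2341) (Q := cut341 x) (R := p2341) Ww); try by_entries.
rewrite (avd_cons_bump (P := p4231) (Q := below x p231) (R := p4231) Ww);
  try by_entries.
by do 6![case: (avd _ _) => //=].
Qed.

(** Deleting the 4 from 2341 or from 4231 leaves 231. *)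
Lemma avU_avT n w : w \in words n ->
  avU w = [&& avT w & avd p231 w].
Proof.
move=> Ww; rewrite /avU /avT andbC -!andbA; congr andb.
case: (boolP (avd p231 w)) => [/avdP av | ]; last by rewrite !andbF.
rewrite andbT; symmetry; apply/andP; split; apply/avdP.
  move=> [|b [|c [|d [|a [|? ?]]]]] //= su; apply/negP => /and3P[ab bc cd].
  have /av /= : subseq [:: b; c; a] w.
    apply: subseq_trans su.
    exact: (mask_subseq [:: true; true; false; true] [:: b; c; d; a]).
  by rewrite ab bc.
move=> [|d [|b [|c [|a [|? ?]]]]] //= su; apply/negP => /and3P[ab bc cd].
have /av /= : subseq [:: b; c; a] w by apply: subseq_trans su; apply: subseq_cons.
by rewrite ab bc.
Qed.

(** * Position and deletion of the maximum *)

Lemma subseq_mid u v a n b : a \in u -> b \in v -> subseq [:: a; n; b] (u ++ n :: v).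
Proof.
move=> au bv; rewrite -[[:: _; _; _]]/([:: a] ++ [:: n; b]).
by rewrite cat_subseq ?sub1seq //= eqxx sub1seq.
Qed.

Lemma words_split_max n w : w \in words n.+1 ->
  exists2 uv, w = uv.1 ++ n :: uv.2 &
    forall y, (y < n) = (y \in uv.1) || (y \in uv.2).
Proof.
move=> Ww; have: n \in w by rewrite (words_mem Ww) !inE.
case/splitPr Dw: {1}w / => [u v]; exists (u, v) => //= y.
rewrite Dw in Ww; have := words_mem Ww y; have := words_uniq Ww.
rewrite cat_uniq /= mem_cat !inE ltnS negb_or => /and3P[_ /andP[nu _] /andP[nv _]].
by rewrite leq_eqVlt; case: eqP => [-> _|_ ->] //; rewrite ltnn (negPf nu) (negPf nv).
Qed.

(** A letter before [n] and one after it lie on the same side of the cut: low then high gives 143,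
    high then low gives 341. With letters on both sides of [n], all of them would be low or all
    high, but 0 is low and [n.-1] is high. *)
Lemma max_at_end n x w : 0 < x < n -> w \in words n.+1 ->
  avd (cut143 x) w -> avd (cut341 x) w -> (head 0 w == n) || (last 0 w == n).
Proof.
move=> /andP[x_gt0 x_ltn] /words_split_max[[u v] /= -> memuv] /avdP av143 /avdP av341.
have p143 a b au bv := av143 _ (@subseq_mid u v a n b au bv).
have p341 a b au bv := av341 _ (@subseq_mid u v a n b au bv) => {av143 av341}.
case: u => [|y u] in memuv p143 p341 *; first by rewrite /= eqxx.
case: v => [|z v] in memuv p143 p341 *; first by rewrite last_cat /= eqxx orbT.
have yu := mem_head y u; have zv := mem_head z v.
have := memuv y; rewrite yu => lt_yn; have := memuv z; rewrite zv orbT => lt_zn.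
have := memuv 0; have := memuv n.-1.
rewrite (_ : 0 < n) 1?(_ : n.-1 < n); try lia.
move=> /esym/orP[hu|hv] /esym/orP[lu|lv].
- by have := p143 _ _ lu zv; have := p341 _ _ hu zv; rewrite /=; lia.
- by have := p143 _ _ yu lv; have := p341 _ _ hu lv; rewrite /=; lia.
- by have := p143 _ _ lu hv; rewrite /=; lia.
- by have := p143 _ _ yu hv; have := p341 _ _ yu lv; rewrite /=; lia.
Qed.

(** By 31, no low letter follows [n]. So 0 precedes it, and a high letter after [n] would complete a
    143. *)
Lemma max_last n x w : 0 < x <= n -> w \in words n.+1 ->
  avd (cut31 x) w -> avd (cut143 x) w -> last 0 w == n.
Proof.
move=> /andP[x_gt0 x_ltn] /words_split_max[[u v] /= -> memuv] /avdP av21 /avdP av143.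
have p143 a b au bv := av143 _ (@subseq_mid u v a n b au bv).
have p21 b : b \in v -> ~~ cut31 x [:: n; b].
  move=> bv; apply: av21; apply: subseq_trans (suffix_subseq _ _).
  by rewrite /= eqxx sub1seq.
rewrite {av143 av21}last_cat /=.
case: v => [|z v] in memuv p143 p21 *; first by rewrite eqxx.
have zv := mem_head z v.
have := memuv z; rewrite zv orbT => lt_zn.
have := memuv 0; rewrite (leq_trans x_gt0 x_ltn) => /esym/orP[lu|lv].
- by have := p143 _ _ lu zv; have := p21 _ zv; rewrite /=; lia.
- by have := p21 _ lv; rewrite /=; lia.
Qed.

(** No pattern ends with its largest letter; the same holds for T. *)
Lemma avU_rcons n w : w \in words n -> avU (rcons w n) = avU w.
Proof. by move=> Ww; rewrite /avU !(avd_rcons_max Ww) //; by_entries. Qed.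

Lemma avT_rcons n w : w \in words n -> avT (rcons w n) = avT w.
Proof. by move=> Ww; rewrite /avT !(avd_rcons_max Ww) //; by_entries. Qed.

Lemma avU_cons_max n w : w \in words n -> avU (n :: w) = avU w.
Proof. by move=> Ww; rewrite /avU !(avd_cons_max Ww) //; by_entries. Qed.

(** A leading maximum can only play the 4 of 4231, which forbids 231 in the rest. *)
Lemma avT_cons_max n w : w \in words n -> avT (n :: w) = avU w.
Proof.
move=> Ww; rewrite (avU_avT Ww) /avT (avd_cons_max (P := p2143) Ww); last by_entries.
rewrite (avd_cons_max (P := p2341) Ww); last by_entries.
have ->: avd p4231 (n :: w) = avd p231 w && avd p4231 w.
  by rewrite avd_cons; congr andb; apply: (eq_avd_words Ww); by_entries.
by do 4![case: (avd _ _) => //=].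
Qed.

(** * Counts by first letter *)

Definition numT n := count avT (words n).
Definition numU n := count avU (words n).
(* These words have length n.+1, so below n ignores their maximum. *)
Definition numV n := count [pred w | avT w && avd (below n p231) w] (words n.+1).
(* numT_head n x, numU_head n x and numV_head n x count the words with first
   letter x and length one more than that of the words w below. *)
Definition numT_head n x := count [pred w |
  [&& avT w, avd (cut143 x) w, avd (cut341 x) w & avd (below x p231) w]] (words n).
Definition numU_head n x :=
  count [pred w | [&& avU w, avd (cut31 x) w & avd (cut143 x) w]] (words n).
(** What [numT_head] becomes once a leading maximum is deleted. *)
Definition numU_cut n x := count [pred w | avU w && avd (cut143 x) w] (words n).
Definition numV_head n x := count [pred w |
  [&& avT w, avd (below n p231) w, avd (cut143 x) w, avd (cut341 x) w
    & avd (below n (cut31 x)) w]] (words n.+1).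

(** * Recurrences for U *)

Lemma numU_recl n : numU n.+1 = \sum_(x < n.+1) numU_head n x.
Proof.
rewrite /numU count_words_recl; apply: eq_bigr => x _.
by apply: eq_in_count => w Ww /=; rewrite (avU_cons _ Ww).
Qed.

(** Cut patterns need both a low and a high letter: x = 0 leaves no low one, x = n no high one. *)
Lemma numU_head0 n : numU_head n 0 = numU n.
Proof.
apply: eq_in_count => w Ww /=.
by rewrite !(avd_words Ww) ?andbT //; by_entries.
Qed.

Lemma numU_headn n : numU_head n n = numU n.
Proof.
apply: eq_in_count => w Ww /=.
by rewrite !(avd_words Ww) ?andbT //; by_entries.
Qed.

(* The maximum must be the last letter. *)
Lemma numU_head_mid n x : 0 < x <= n -> numU_head n.+1 x = numU_head n x.
Proof.
move=> xn; rewrite /numU_head.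
transitivity (count [pred w | [&& avU w, avd (cut31 x) w & avd (cut143 x) w]
    && (last 0 w == n)] (words n.+1)).
  apply: eq_in_count => w Ww /=; case: and3P => //= -[_ av21 av143].
  by rewrite (max_last xn Ww).
rewrite count_words_rcons; apply: eq_in_count => w Ww /=.
by rewrite (avU_rcons Ww) !(avd_rcons_max Ww) //; by_entries.
Qed.

(** Trailing maxima are removed one by one until no high letter is left, at length [x]. *)
Lemma numU_headE n x : 0 < x <= n -> numU_head n x = numU x.
Proof.
elim: n => [|n IHn]; first by case: x.
case/andP=> x_gt0; rewrite leq_eqVlt => /predU1P[-> | lt_xn]; first exact: numU_headn.
by rewrite numU_head_mid ?IHn ?x_gt0.
Qed.

(** 143 takes two high letters, and only [n] is high. *)
Lemma numU_cut_diag n : numU_cut n.+1 n = numU n.+1.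
Proof.
apply: eq_in_count => w Ww /=.
by rewrite !(avd_words Ww) ?andbT //; by_entries.
Qed.

Lemma avd_cut341_avU x w : avU w -> avd (cut341 x) w.
Proof.
case/andP=> av231 _; apply: avd_sub av231.
by move=> [|? [|? [|? [|? ?]]]] _ //=; lia.
Qed.

(** The maximum stands at either end, since 231-avoidance supplies the 341 condition, and either
    deletion leaves the same constraints. *)
Lemma numU_cut_mid n x : 0 < x < n -> numU_cut n.+1 x = numU_cut n x + numU_cut n x.
Proof.
move=> xn; have n_gt0 : 0 < n by lia.
rewrite {1}/numU_cut count_words_ends //.
  congr addn; apply: eq_in_count => w Ww /=.
    by rewrite (avU_cons_max Ww) (avd_cons_max Ww) //; by_entries.
  by rewrite (avU_rcons Ww) (avd_rcons_max Ww) //; by_entries.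
move=> w Ww /andP[avw av143].
exact: max_at_end xn Ww av143 (avd_cut341_avU x avw).
Qed.

(** * Recurrences for T *)

Lemma numT_recl n : numT n.+1 = \sum_(x < n.+1) numT_head n x.
Proof.
rewrite /numT count_words_recl; apply: eq_bigr => x _.
by apply: eq_in_count => w Ww /=; rewrite (avT_cons _ Ww).
Qed.

Lemma numT_head0 n : numT_head n 0 = numT n.
Proof.
apply: eq_in_count => w Ww /=.
by rewrite !(avd_words Ww) ?andbT //; by_entries.
Qed.

Lemma numT_headn n : numT_head n n = numU n.
Proof.
apply: eq_in_count => w Ww /=; rewrite (avU_avT Ww).
rewrite (avd_words (P := cut143 n) Ww) ?(avd_words (P := cut341 n) Ww); try by_entries.
by congr andb; apply: (eq_avd_words Ww); by_entries.
Qed.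

(** With the single high letter [n], neither 143 nor 341 can occur. *)
Lemma numT_head_last n : numT_head n.+1 n = numV n.
Proof.
apply: eq_in_count => w Ww /=.
by rewrite (avd_words (P := cut143 n) Ww) ?(avd_words (P := cut341 n) Ww);
  try by_entries.
Qed.

(** The first term counts leading maxima, where 231-avoidance entails the 341 and [below x p231]
    conditions; the second counts trailing ones. *)
Lemma numT_head_mid n x : 0 < x < n -> numT_head n.+1 x = numU_cut n x + numT_head n x.
Proof.
move=> xn; have n_gt0 : 0 < n by lia.
rewrite {1}/numT_head count_words_ends //.
  congr addn; apply: eq_in_count => w Ww /=.
    rewrite (avT_cons_max Ww).
    rewrite [avd (cut143 x) (n :: w)](avd_cons_max Ww); last by_entries.
    rewrite [avd (cut341 x) (n :: w)](avd_cons_max Ww); last by_entries.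
    rewrite [avd (below x p231) (n :: w)](avd_cons_max Ww); last by_entries.
    case avw: (avU w) => //=; rewrite avd_cut341_avU //= andbC.
    rewrite (avd_sub _ (proj1 (andP avw))) // => u _ /andP[//].
  by rewrite (avT_rcons Ww) !(avd_rcons_max Ww) //; by_entries.
by move=> w Ww /and4P[_ av143 av341 _]; apply: max_at_end xn Ww av143 av341.
Qed.

(** * Recurrences for V *)

Lemma numV_recl n : numV n.+1 = \sum_(x < n.+1) numV_head n x + numU n.+1.
Proof.
rewrite /numV count_words_recl big_ord_recr; congr addn.
  apply: eq_bigr => x _; apply: eq_in_count => w Ww /=; have := ltn_ord x => xn.
  rewrite (avT_cons _ Ww) (avd_cons_bump (P := below n.+1 p231)
    (Q := below n (cut31 x)) (R := below n p231) Ww); try by_entries.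
  case av: (avd (below n p231) w); last by rewrite !andbF.
  (* As x <= n, the condition left by 4231 follows from [below n p231]. *)
  rewrite (avd_sub (P := below x p231) _ av) ?andbT -?andbA //.
  by move=> [|? [|? [|? [|? ?]]]] _ //; rewrite /below /=; lia.
(* The leading letter [n.+1] is not below [n.+1], hence [pred0]. *)
apply: eq_in_count => w Ww /=; rewrite (avT_cons _ Ww) (avd_cons_bump
  (P := below n.+1 p231) (Q := pred0) (R := p231) Ww); try by_entries.
rewrite (avU_avT Ww) (avd_words (P := pred0) Ww) //.
rewrite (avd_words (P := cut143 n.+1) Ww) ?(avd_words (P := cut341 n.+1) Ww);
  try by_entries.
rewrite /= -andbA; congr andb; rewrite andb_idl // => av.
by apply: avd_sub av => u _ /andP[].
Qed.

Lemma numV_head0 n : numV_head n 0 = numV n.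
Proof.
apply: eq_in_count => w Ww /=.
rewrite (avd_words (P := cut143 0) Ww) ?(avd_words (P := cut341 0) Ww); try by_entries.
by rewrite (avd_words (P := below n (cut31 0)) Ww) ?andbT //; by_entries.
Qed.

Lemma numV_headn n : numV_head n n = numV n.
Proof.
apply: eq_in_count => w Ww /=.
rewrite (avd_words (P := cut143 n) Ww) ?(avd_words (P := cut341 n) Ww); try by_entries.
by rewrite (avd_words (P := below n (cut31 n)) Ww) ?andbT //; by_entries.
Qed.

(** Once the maximum is deleted from an end, the [below n] conditions become plain 231 and 31. In
    both cases the rest must avoid U: at the front by [avT_cons_max], at the back because T and 231
    together amount to U. *)
Lemma numV_head_mid n x : 0 < x < n -> numV_head n x = numU_head n x + numU_head n x.
Proof.
move=> xn; have n_gt0 : 0 < n by lia.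
rewrite {1}/numV_head count_words_ends //.
  congr addn; apply: eq_in_count => w Ww /=.
    rewrite (avT_cons_max Ww).
    rewrite [avd (below n p231) _](avd_cons_max Ww); last by_entries.
    rewrite [avd (cut143 x) (n :: w)](avd_cons_max Ww); last by_entries.
    rewrite [avd (cut341 x) (n :: w)](avd_cons_max Ww); last by_entries.
    rewrite [avd (below n (cut31 x)) _](avd_cons_max Ww); last by_entries.
    rewrite (eq_avd_words (P := below n p231) (Q := p231) Ww); last by_entries.
    rewrite (eq_avd_words (P := below n (cut31 x)) (Q := cut31 x) Ww); last by_entries.
    case avw: (avU w) => //=; rewrite avd_cut341_avU //= (proj1 (andP avw)) /=.
    by rewrite andbC.
  rewrite (avT_rcons Ww) !(avd_rcons_max Ww); try by_entries.
  rewrite (eq_avd_words (P := below n p231) (Q := p231) Ww); last by_entries.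
  rewrite (eq_avd_words (P := below n (cut31 x)) (Q := cut31 x) Ww); last by_entries.
  rewrite andbA -(avU_avT Ww); case avw: (avU w) => //=.
  by rewrite avd_cut341_avU //= andbC.
by move=> w Ww /and5P[_ _ av143 av341 _]; apply: max_at_end xn Ww av143 av341.
Qed.

End Statistics.

(** * Recurrences and closed forms *)

Section ClosedForms.
Implicit Types N : nat.

(** Total contribution of the leading maxima to [numT_rec]. *)
Definition numW N := \sum_(i < N) numU_cut N.+1 i.+1.

Lemma numW_rec N : numW N.+1 = 2 * numW N + numU N.+2.
Proof.
rewrite /numW big_ord_recr /= numU_cut_diag big_distrr /=; congr addn.
by apply: eq_bigr => i _; rewrite numU_cut_mid ?mul2n -?addnn //= ltnS ltn_ord.
Qed.

Lemma numU_rec N : numU N.+2 = numU N.+1 + \sum_(i < N.+1) numU i.+1.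
Proof.
rewrite numU_recl big_ord_recl numU_head0; congr addn; apply: eq_bigr => i _.
by rewrite /= /bump /= add1n numU_headE //= ltn_ord.
Qed.

Lemma numV_rec N : numV N.+2 = 2 * numV N.+1 + 2 * \sum_(i < N) numU i.+1 + numU N.+2.
Proof.
rewrite numV_recl big_ord_recl numV_head0 big_ord_recr /= /bump /= add1n numV_headn.
rewrite big_distrr /= (eq_bigr (fun i : 'I_N => 2 * numU i.+1)); first by lia.
by move=> i _; rewrite add1n numV_head_mid ?numU_headE //=; have := ltn_ord i; lia.
Qed.

(** The inner sum over first letters is eliminated between two consecutive lengths; subtracted terms
    stand on the left. *)
Lemma numT_rec N : numT N.+3 + numT N.+1 + numU N.+1 =
  2 * numT N.+2 + numW N + numV N.+1 + numU N.+2.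
Proof.
have ends n : numT n.+2 =
    numT n.+1 + \sum_(i < n) numT_head n.+1 i.+1 + numT_head n.+1 n.+1.
  rewrite numT_recl big_ord_recl numT_head0 big_ord_recr /= /bump /= add1n addnA.
  by under eq_bigr do rewrite add1n.
rewrite ends big_ord_recr /= numT_head_last numT_headn; have := ends N.
rewrite numT_headn.
rewrite (eq_bigr (fun i : 'I_N => numU_cut N.+1 i.+1 + numT_head N.+1 i.+1)).
  by rewrite big_split /= -/(numW N); lia.
by move=> i _; rewrite numT_head_mid //= ltnS ltn_ord.
Qed.

(** * Initial values and closed forms *)

Lemma numU1 : numU 1 = 1. Proof. by rewrite numU_recl big_ord1 numU_head0. Qed.
Lemma numU2 : numU 2 = 2. Proof. by rewrite numU_rec big_ord1 numU1. Qed.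
Lemma numV1 : numV 1 = 2. Proof. by rewrite numV_recl big_ord1 numV_head0. Qed.
Lemma numT0 : numT 0 = 1. Proof. by []. Qed.
Lemma numT1 : numT 1 = 1. Proof. by []. Qed.
Lemma numT2 : numT 2 = 2. Proof. by []. Qed.

(** Difference of two instances of [numU_rec]; this is the recurrence of every other Fibonacci
    number. *)
Lemma numU_fib N : numU N.+3 + numU N.+1 = 3 * numU N.+2.
Proof. by rewrite numU_rec big_ord_recr /=; have /= := numU_rec N; lia. Qed.

Lemma sum_numU N : \sum_(i < N) numU i.+1 + 2 * numU N.+1 = numU N.+2.
Proof. have /= := numU_rec N; rewrite big_ord_recr /=; lia. Qed.

Lemma numW_closed N : numW N + numU N.+1 + 3 * 2 ^ N = 2 * numU N.+2.
Proof.
elim: N => [|N IHN]; first by rewrite /numW big_ord0 numU1 numU2.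
by rewrite numW_rec expnS; have := numU_fib N; lia.
Qed.

Lemma numV_closed N : numV N.+1 + 3 * 2 ^ N = numU N.+1 + 2 * numU N.+2.
Proof.
elim: N => [|N IHN]; first by rewrite numV1 numU1 numU2.
by rewrite numV_rec expnS; have := numU_fib N; have /= := sum_numU N; lia.
Qed.

Lemma numT_closed N : numT N.+1 + 6 * 2 ^ N = 2 * N + 3 + 2 * numU N.+1 + numU N.+2.
Proof.
(* [numT_rec] has order two, so the induction carries two consecutive values. *)
suff [] : numT N.+1 + 6 * 2 ^ N = 2 * N + 3 + 2 * numU N.+1 + numU N.+2 /\
  numT N.+2 + 6 * 2 ^ N.+1 = 2 * N.+1 + 3 + 2 * numU N.+2 + numU N.+3 by [].
elim: N => [|N [IH1 IH2]].
  by have := numU_fib 0; rewrite numT1 numT2 numU1 numU2; lia.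
split=> //; move: IH1 IH2 (numT_rec N) (numW_closed N) (numV_closed N).
move: (numU_fib N) (numU_fib N.+1).
by rewrite !expnS; lia.
Qed.

Lemma numT3 : numT 3 = 6.
Proof.
have := numT_closed 2; have := numU_fib 0; have := numU_fib 1.
by rewrite numU1 numU2; lia.
Qed.

Lemma numT4 : numT 4 = 21.
Proof.
have := numT_closed 3; have := numU_fib 0; have := numU_fib 1; have := numU_fib 2.
by rewrite numU1 numU2; lia.
Qed.

Lemma numT5 : numT 5 = 72.
Proof.
have := numT_closed 4; have := numU_fib 0; have := numU_fib 1; have := numU_fib 2.
by have := numU_fib 3; rewrite numU1 numU2; lia.
Qed.

(** The coefficients are those of the expanded denominator: (1-x)^2 annihilates the affine part of
    [numT_closed], 1-2x the powers of 2, and 1-3x+x^2 the [numU] terms. *)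
Lemma numT_linear_rec N : numT N.+2.+4 + 18 * numT N.+4 + 11 * numT N.+2 =
  7 * numT N.+2.+3 + 21 * numT N.+3 + 2 * numT N.+1.
Proof.
have := numT_closed N.+2.+3; have := numT_closed N.+4; have := numT_closed N.+3.
have := numT_closed N.+2; have := numT_closed N.+1; have := numT_closed N.
have := numU_fib N.+4; have := numU_fib N.+3; have := numU_fib N.+2.
have := numU_fib N.+1; have := numU_fib N; rewrite !expnS; lia.
Qed.

End ClosedForms.

(** * Quotients of formal power series *)

Section PowerSeries.
Local Open Scope ring_scope.
Variable R : fieldType.
Implicit Types a b c : fps R.

Definition trunc n a : {poly R} := \poly_(i < n) a i.

(** Carries the ring laws of polynomials over to series. *)
Lemma fps_mulE m n a b : (n < m)%N -> fps_mul a b n = (trunc m a * trunc m b)`_n.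
Proof.
move=> lt_nm; rewrite coefM; apply: eq_bigr => k _.
by rewrite !coef_poly !(leq_ltn_trans _ lt_nm) ?leq_subr // -ltnS.
Qed.

Lemma fps_mulC a b : fps_mul a b =1 fps_mul b a.
Proof. by move=> n; rewrite !(fps_mulE _ _ (ltnSn n)) mulrC. Qed.

Lemma fps_mulA a b c : fps_mul a (fps_mul b c) =1 fps_mul (fps_mul a b) c.
Proof.
move=> n; transitivity ((trunc n.+1 a * (trunc n.+1 b * trunc n.+1 c))`_n).
  rewrite coefM; apply: eq_bigr => k _.
  by rewrite coef_poly ltn_ord -fps_mulE // ltnS leq_subr.
rewrite mulrA coefM; apply: eq_bigr => k _.
by rewrite coef_poly ltnS leq_subr -fps_mulE.
Qed.

Lemma eq_fps_mul a a' b b' : a =1 a' -> b =1 b' -> fps_mul a b =1 fps_mul a' b'.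
Proof. by move=> eqa eqb n; apply: eq_bigr => k _; rewrite eqa eqb. Qed.

Lemma fps_mul1 a : fps_mul a (fps_poly 1) =1 a.
Proof.
move=> n; rewrite fps_mulC /fps_mul big_ord_recl /fps_poly coef1 mul1r subn0.
by rewrite big1 ?addr0 // => k _; rewrite coef1 mul0r.
Qed.

(** A quotient is identified by multiplying out, without computing the inverse series. *)
Lemma fps_divP a b c : b 0%N != 0 -> fps_mul b c =1 a -> c =1 fps_div a b.
Proof.
move=> b0 eq_bc n; rewrite -[LHS]fps_mul1 -(eq_fps_mul (frefl c) (fps_mulV b0)).
rewrite fps_mulA; apply: eq_fps_mul => // i.
by rewrite fps_mulC eq_bc.
Qed.

End PowerSeries.

(** * From words to permutations *)

Section Permutations.

Lemma contains_avd (P : pred (seq nat)) t w :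
    (forall u, order_iso (map S u) t = P u) ->
  ~~ contains (map S w) t = avd P w.
Proof.
move=> eqP; apply/idP/avdP => [/containsP nc u su | av].
  apply/negP => Pu; apply: nc; exists (map S u); last by rewrite eqP.
  exact: map_subseq.
apply/containsP => -[_ /subseqP[m sz_m ->]].
by rewrite -map_mask eqP => /(negP (av _ (mask_subseq m w))).
Qed.

(** Turns the quantifiers over ordinals into a finite check that computes for concrete [n]. *)
Lemma order_isoE u v n : size u = n -> size v = n -> order_iso u v =
  all (fun i => all (fun j => (nth 0 u i < nth 0 u j) == (nth 0 v i < nth 0 v j))
    (iota 0 n)) (iota 0 n).
Proof.
move=> szu szv; apply/order_isoP/allP => [[_ iso] i|iso].
  rewrite mem_iota => lti; apply/allP => j; rewrite mem_iota => ltj.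
  by apply/eqP/iso; rewrite szu.
split=> [|i j lti ltj]; first by rewrite szu.
have /iso/allP/(_ j) : i \in iota 0 n by rewrite mem_iota -szu.
by rewrite mem_iota -szu => /(_ ltj)/eqP.
Qed.

Lemma order_iso_size u v : order_iso u v -> size u = size v.
Proof. by case/order_isoP. Qed.

Ltac pattern_iso := move=> [|a [|b [|c [|d [|e u]]]]] /=;
  try (by apply/negP => /order_iso_size); rewrite (order_isoE (n := 4)) //=; lia.

Lemma order_iso_2143 u : order_iso (map S u) [:: 2; 1; 4; 3] = p2143 u.
Proof. move: u; pattern_iso. Qed.
Lemma order_iso_2341 u : order_iso (map S u) [:: 2; 3; 4; 1] = p2341 u.
Proof. move: u; pattern_iso. Qed.
Lemma order_iso_4231 u : order_iso (map S u) [:: 4; 2; 3; 1] = p4231 u.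
Proof. move: u; pattern_iso. Qed.

Lemma card_avoiders n :
  #|avoiders [:: [:: 2; 1; 4; 3]; [:: 2; 3; 4; 1]; [:: 4; 2; 3; 1]] n| = numT n.
Proof.
pose word (s : 'S_n) := [seq val (s i) | i <- enum 'I_n].
have one_lineE s : one_line s = map S (word s) by rewrite -map_comp.
have word_inj : injective word.
  move=> s t /eq_in_map eq_st; apply/permP => i; apply/val_inj/eq_st.
  by rewrite mem_enum.
have word_words : perm_eq (map word (enum 'S_n)) (words n).
  have Uw : uniq (map word (enum 'S_n)) by rewrite map_inj_uniq ?enum_uniq.
  (* The permutations give n! distinct members of [words n], which has size n!, so all are
     reached. *)
  have [||_ eqw] := @uniq_min_size _ _ (words n) Uw; last first.
  - by apply: uniq_perm => //; apply: permutations_uniq.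
  - by rewrite size_map -cardE size_permutations ?iota_uniq // size_iota card_Sn.
  move=> _ /mapP[s _ ->]; apply: wordsI => [|y].
    by rewrite map_inj_uniq ?enum_uniq // => i j /val_inj/perm_inj.
  rewrite inE /=; apply/mapP/idP => [[i _ ->] | lt_yn]; first exact: ltn_ord.
  by exists (s^-1%g (Ordinal lt_yn)); rewrite ?mem_enum // permKV.
rewrite /numT -(seq.permP word_words) count_map enumT cardE /enum_mem size_filter.
apply: eq_count => s /=; rewrite !inE /= one_lineE /avT andbT.
by rewrite (contains_avd _ order_iso_2143) (contains_avd _ order_iso_2341)
  (contains_avd _ order_iso_4231).
Qed.

End Permutations.

Local Open Scope ring_scope.

Theorem theorem4 :
  gen_fun [:: [:: 2; 1; 4; 3]; [:: 2; 3; 4; 1]; [:: 4; 2; 3; 1]]%N =1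
  fps_div
    (fps_poly (1 - 6%:R *: 'X + 13%:R *: 'X^2 - 11%:R *: 'X^3 + 5%:R *: 'X^4))
    (fps_poly ((1 - 'X) ^+ 2 * (1 - 2%:R *: 'X) * (1 - 3%:R *: 'X + 'X^2))).
Proof.
rewrite (_ : (1 - 'X) ^+ 2 * _ * _ =
    Poly [:: 1; - 7%:R; 18%:R; - 21%:R; 11%:R; - 2%:R]); last first.
  rewrite /= !cons_poly_def !rmorphN !rmorph_nat /= !scaler_nat.
  ring.
rewrite (_ : 1 - _ + _ - _ + _ = Poly [:: 1; - 6%:R; 13%:R; - 11%:R; 5%:R]); last first.
  by rewrite /= !cons_poly_def !rmorphN !rmorph_nat /= !scaler_nat; ring.
apply: fps_divP => [|n]; first by rewrite /fps_poly coef_Poly.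
rewrite /fps_mul /fps_poly coef_Poly.
under eq_bigr do rewrite coef_Poly /gen_fun card_avoiders.
(* Coefficients 0 to 5 come from the initial values; from 6 on, [numT_linear_rec] makes them
   vanish. *)
case: n => [|[|[|[|[|[|n]]]]]].
1-6: by rewrite !big_ord_recl big_ord0 /= /bump /= ?add1n ?subSS !subn0
  ?(numT0, numT1, numT2, numT3, numT4, numT5); ring.
have := congr1 (fun m => m%:R : rat) (numT_linear_rec n).
rewrite /= 4!natrD 5!natrM => numTE.
(* Past index 5 the denominator contributes the default 0 of [nth]. *)
rewrite !big_ord_recl big1 => [|i _]; last first.
  by rewrite /= /bump /= !add1n /= ?nth_nil mul0r.
rewrite /= /bump /= !add1n !subSS !subn0. lra.
Qed.
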